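(* Let $X$ be a reflexive Banach space over $\mathbb{K}$. (i) If $X^*$ is locally uniformly rotund (LUR), then the pair $(X,\mathbb{K})$ has property $\mathbf{L}_{p,o}$. (ii) If the pair $(X,\mathbb{K})$ has property $\mathbf{L}_{p,o}$, then $X^*$ is strictly convex.
   Context: Banach spaces are over $\mathbb{K}$, which is $\mathbb{R}$ or $\mathbb{C}$. $S_X$ denotes the unit sphere of $X$, $X^*$ its topological dual, and $\mathcal{L}(X,Y)$ the space of bounded linear operators from $X$ to $Y$ with the operator norm (so $\mathcal{L}(X,\mathbb{K})=X^*$). A pair $(X,Y)$ of Banach spaces has property $\mathbf{L}_{p,o}$ if for every $\varepsilon>0$ and every $T\in\mathcal{L}(X,Y)$ with $\|T\|=1$ there is $\eta(\varepsilon,T)>0$ such that whenever $x\in S_X$ satisfies $\|T(x)\|>1-\eta(\varepsilon,T)$, there is $S\in\mathcal{L}(X,Y)$ with $\|S\|=1$, $\|S(x)\|=1$ and $\|S-T\|<\varepsilon$. A Banach space $Z$ is strictly convex if $\|\frac{x+y}{2}\|<1$ whenever $x,y\in S_Z$, $x\neq y$. $Z$ is locally uniformly rotund (LUR) if for all $x,x_n\in S_Z$ ($n\in\mathbb{N}$), $\lim_n\|x_n+x\|=2$ implies $\lim_n\|x_n-x\|=0$. *)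

(* Defs.v *)
(* Bounded operators, duals and the property L_{p,o} over K = R or K = C.     *)
(* Written with MathComp-Analysis; C is R[i] from mathcomp-real-closed.       *)
From HB Require Import structures.
From mathcomp Require Import all_boot all_order all_algebra.
From mathcomp Require Import complex.
From mathcomp Require Import all_classical all_reals all_analysis.

Set Implicit Arguments.
Unset Strict Implicit.
Unset Printing Implicit Defensive.
Import Order.TTheory GRing.Theory Num.Theory.
Import numFieldNormedType.Exports.
Local Open Scope classical_set_scope.
Local Open Scope ring_scope.

Variant scalars := RealScalars | ComplexScalars.

(* Norms over a numFieldType K are K-valued, and for a, b : R[i], a <= b means
   Re a <= Re b and Im a = Im b.  Hence 0 < e says that e is real and positive,
   and all inequalities between norms below compare real numbers. *)
Definition scalar_field (R : realType) (k : scalars) : numFieldType :=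
  match k with RealScalars => R | ComplexScalars => R[i] end.

Lemma scalar_field_supremums (R : realType) (k : scalars)
    (A : set (scalar_field R k)) :
  A !=set0 -> (forall a, A a -> 0 <= a) -> ubound A !=set0 ->
  supremums A !=set0.
Proof.
case: k A => /= A A0 Age [M AM].
  exists (sup A); split; first by apply: ub_le_sup; exists M.
  by move=> y yA; exact: ge_sup.
have Areal a : A a -> ((complex.Re a) %:C)%C = a :> R[i].
  by move=> /Age /ger0_real /RRe_real.
have [a0 Aa0] := A0.
have ubR y : ubound A y -> ((complex.Re y) %:C)%C = y :> R[i].
  move=> yA; apply/RRe_real/ger0_real/(le_trans (Age _ Aa0)).
  exact: yA.
have B0 : (@complex.Re R @` A) !=set0 by exists (complex.Re a0); exists a0.
have ubB y : ubound A y -> ubound (@complex.Re R @` A) (complex.Re y).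
  move=> yA _ [a Aa <-]; rewrite -lecR Areal// ubR//; exact: yA.
exists (sup (@complex.Re R @` A))%:C%C; split.
  move=> a Aa; rewrite -(Areal _ Aa) lecR; apply: ub_le_sup.
    by exists (complex.Re M); exact: ubB.
  by exists a.
move=> y yA; rewrite -(ubR _ yA) lecR; apply: ge_sup => //.
exact: ubB.
Qed.

Section BoundedOperator.
Context (K : numFieldType) (X Y : normedModType K).

Definition bounded_linear : {pred X -> Y} := fun T =>
  `[< linear T /\ exists M : K, forall x, `|T x| <= M * `|x| >].

Lemma bounded_linear_submod_closed : submod_closed bounded_linear.
Proof.
split; first apply/asboolP; last move=> a f g /asboolP fL /asboolP gL.
  split; first by move=> a x y; rewrite /= scaler0 addr0.
  by exists 0 => x; rewrite /= normr0 mul0r.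
apply/asboolP.
have [lf [Mf fM]] := fL; have [lg [Mg gM]] := gL; split.
  move=> b x y.
  change (a *: f (b *: x + y) + g (b *: x + y) =
    b *: (a *: f x + g x) + (a *: f y + g y)).
  by rewrite lf lg !scalerDr addrACA !scalerA [a * b]mulrC.
exists (`|a| * Mf + Mg) => x.
change (`|a *: f x + g x| <= (`|a| * Mf + Mg) * `|x|).
apply: (le_trans (ler_normD _ _)); rewrite mulrDl lerD//.
by rewrite normrZ -mulrA ler_wpM2l.
Qed.

HB.instance Definition _ :=
  GRing.isSubmodClosed.Build K (X -> Y) bounded_linear
    bounded_linear_submod_closed.

(* The space L(X, Y). *)
Record bounded_operator := BoundedOperator {
  operator_fun :> X -> Y;
  operator_bounded_linear : operator_fun \in bounded_linear }.

HB.instance Definition _ := [isSub for operator_fun].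
HB.instance Definition _ := [Choice of bounded_operator by <:].
HB.instance Definition _ :=
  [SubChoice_isSubLmodule of bounded_operator by <:].

Definition opnorm (T : bounded_operator) : K :=
  supremum 0 [set `|T x| | x in [set x : X | `|x| <= 1]].

Lemma operatorP (S T : bounded_operator) : (forall x, S x = T x) -> S = T.
Proof. by move=> ST; apply/val_inj/funext. Qed.

Lemma operator_linear (T : bounded_operator) : linear T.
Proof. by have /asboolP[] := operator_bounded_linear T. Qed.

Lemma operator_scale (T : bounded_operator) a x : T (a *: x) = a *: T x.
Proof.
have := operator_linear T a x 0; rewrite !addr0 => ->.
have := operator_linear T (-1) 0 0; rewrite scaler0 addr0 scaleN1r addNr => ->.
by rewrite addr0.
Qed.

Lemma operator_bounded (T : bounded_operator) :
  exists M : K, forall x, `|T x| <= M * `|x|.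
Proof. by have /asboolP[] := operator_bounded_linear T. Qed.

Lemma addoE (S T : bounded_operator) x : (S + T) x = S x + T x.
Proof. by []. Qed.

Lemma scaleoE a (T : bounded_operator) x : (a *: T) x = a *: T x.
Proof. by []. Qed.

End BoundedOperator.

Section OperatorNorm.
Context (R : realType) (k : scalars).
Let K : numFieldType := scalar_field R k.
Context (X Y : normedModType (scalar_field R k)).
Implicit Types S T : bounded_operator X Y.

Let image_ball T : set K := [set `|T x| | x in [set x : X | `|x| <= 1]].

Lemma opnorm_supremums T : supremums (image_ball T) (opnorm T).
Proof.
have A0 : image_ball T !=set0.
  by exists `|T 0|; exists 0 => //=; rewrite normr0 ler01.
have [z zA] : supremums (image_ball T) !=set0.
  apply: scalar_field_supremums => //; first by move=> _ [x _ <-].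
  have [M TM] := operator_bounded T; exists `|M| => _ [x /= x1 <-].
  rewrite -[`|T x|]normr_id.
  apply: (@le_trans _ _ `|M * `|x| |).
    rewrite [leRHS]ger0_norm; first by rewrite normr_id.
    exact: le_trans (TM x).
  by rewrite normrM normr_id ler_piMr.
rewrite /opnorm /supremum ifF; last by apply/negbTE/set0P.
by case: xgetP => [y -> //|/(_ z)].
Qed.

Lemma ler_opnorm T x : `|x| <= 1 -> `|T x| <= opnorm T.
Proof. by move=> x1; apply: (opnorm_supremums T).1; exists x. Qed.

Lemma opnorm_le T (M : K) :
  (forall x, `|x| <= 1 -> `|T x| <= M) -> opnorm T <= M.
Proof. by move=> TM; apply: (opnorm_supremums T).2 => _ [x x1 <-]; exact: TM. Qed.

Lemma opnorm_ge0 T : 0 <= opnorm T.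
Proof.
by apply: (le_trans _ (@ler_opnorm T 0 _)) => //; rewrite normr0 ler01.
Qed.

Lemma le_opnormM T x : `|T x| <= opnorm T * `|x|.
Proof.
have [->|x0] := eqVneq x 0.
  by have := operator_scale T 0 0; rewrite !scale0r => ->; rewrite !normr0 mulr0.
have nx : 0 < `|x| by rewrite normr_gt0.
rewrite -ler_pdivrMr// mulrC.
have -> : `|x|^-1 * `|T x| = `|T (`|x|^-1 *: x)|.
  by rewrite operator_scale normrZ normfV normr_id.
by apply: ler_opnorm; rewrite normrZ normfV normr_id mulVf// gt_eqF.
Qed.

Lemma opnormD S T : opnorm (S + T) <= opnorm S + opnorm T.
Proof.
apply: opnorm_le => x x1; rewrite addoE.
by apply: (le_trans (ler_normD _ _)); rewrite lerD// ler_opnorm.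
Qed.

Lemma opnormZ_le (a : K) T : opnorm (a *: T) <= `|a| * opnorm T.
Proof.
by apply: opnorm_le => x x1; rewrite scaleoE normrZ ler_wpM2l// ler_opnorm.
Qed.

Lemma opnormZ (a : K) T : opnorm (a *: T) = `|a| * opnorm T.
Proof.
apply/eqP; rewrite eq_le opnormZ_le/=.
have [->|a0] := eqVneq a 0; first by rewrite normr0 mul0r opnorm_ge0.
rewrite mulrC -ler_pdivlMr ?normr_gt0// mulrC -normfV.
by apply: le_trans (opnormZ_le _ _); rewrite scalerA mulVf// scale1r.
Qed.

Lemma opnorm0_eq0 T : opnorm T = 0 -> T = 0.
Proof.
move=> T0; apply: operatorP => x; apply/eqP; rewrite -normr_le0.
by apply: (le_trans (le_opnormM T x)); rewrite T0 mul0r.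
Qed.

HB.instance Definition _ := Lmodule_isNormed.Build (scalar_field R k)
  (bounded_operator X Y) opnormD opnormZ opnorm0_eq0.

Lemma operator_normE T : `|T| = opnorm T.
Proof. by []. Qed.

End OperatorNorm.

(* Every f : dual X is K-valued; K^o is K seen as a normed space over itself. *)
Definition dual (R : realType) (k : scalars)
    (X : normedModType (scalar_field R k)) : normedModType (scalar_field R k) :=
  bounded_operator X (scalar_field R k)^o.

Section Reflexive.
Context (R : realType) (k : scalars) (X : normedModType (scalar_field R k)).

Lemma bidual_eval_subproof (x : X) :
  (fun f : dual X => f x) \in @bounded_linear _ (dual X) (scalar_field R k)^o.
Proof.
apply/asboolP; split=> [a f g //|].
by exists `|x| => f; rewrite mulrC; exact: le_opnormM.
Qed.

Definition bidual_eval (x : X) : dual (dual X) :=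
  BoundedOperator (bidual_eval_subproof x).

Definition reflexive_space := forall phi : dual (dual X),
  exists x : X, bidual_eval x = phi.

End Reflexive.

Definition strictly_convex (K : numFieldType) (Z : normedModType K) :=
  forall x y : Z, `|x| = 1 -> `|y| = 1 -> x <> y -> `|2^-1 *: (x + y)| < 1.

Definition locally_uniformly_rotund (K : numFieldType) (Z : normedModType K) :=
  forall (x : Z) (x_ : nat -> Z), `|x| = 1 -> (forall n, `|x_ n| = 1) ->
    (fun n => `|x_ n + x|) @ \oo --> (2 : K) ->
    (fun n => `|x_ n - x|) @ \oo --> (0 : K).

Definition property_Lpo (R : realType) (k : scalars)
    (X Y : normedModType (scalar_field R k)) :=
  forall (e : scalar_field R k) (T : bounded_operator X Y), 0 < e -> `|T| = 1 ->
    exists2 eta : scalar_field R k, 0 < eta &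
      forall x : X, `|x| = 1 -> 1 - eta < `|T x| ->
        exists S : bounded_operator X Y,
          [/\ `|S| = 1, `|S x| = 1 & `|S - T| < e].

(* Main.v *)
Require Import Defs.
From HB Require Import structures.
From mathcomp Require Import all_boot all_order all_algebra.
From mathcomp Require Import complex ring lra.
From mathcomp Require Import all_classical all_reals all_analysis.
Import numFieldNormedType.Exports.

(** Everything rests on norming functionals: for x <> 0 there is S in the dual
    with norm 1 and S x = |x| (lemma [norming_functional]).

    LUR implies L_{p,o}.  Let |f| = 1.  If no eta works for f and eps, there are
    unit vectors x_n with |f x_n| -> 1 such that no S within eps of f has
    |S| = |S x_n| = 1.  A norming functional of x_n, rotated by a scalar of
    modulus 1, gives g_n of norm 1 such that |g_n x_n| = 1 and g_n x_n has the
    same argument as f x_n; then |g_n + f| >= 1 + |f x_n| -> 2, so g_n -> f by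
    local uniform rotundity: a contradiction.

    L_{p,o} implies strict convexity.  If two unit functionals f and g have a
    midpoint of norm 1, reflexivity gives a unit vector x at which the midpoint
    takes the value 1, and then f x = g x = 1.  So it is enough that L_{p,o}
    makes X smooth ([Lpo_smooth]).  Suppose that f and g differ, and let v be
    such that g v - f v = 1.  For small t > 0 the functional f almost attains
    its norm in the direction y = x + t v, so L_{p,o} gives S close to f with
    |S| = 1 and S y = |y|, up to rotating S slightly.  But the subdifferential
    of the norm is monotone, so moving from x towards v can only increase the
    value at v: Re S v >= Re g v = 1 + Re f v.  Hence |S - f| >= 1 / |v|, and S
    was not close to f.

    The norming functionals come from the Hahn-Banach theorem, proved here by
    minimality: by Zorn's lemma every sublinear functional dominates a minimal
    one, and a minimal one is linear.  Over the complex field this is applied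
    to the underlying real space, and the real functional f so obtained is the
    real part of the complex functional x |-> f x - i f (i x). *)

Set Implicit Arguments.
Unset Strict Implicit.
Unset Printing Implicit Defensive.
Import Order.TTheory GRing.Theory Num.Theory.
Local Open Scope classical_set_scope.
Local Open Scope ring_scope.

(** * The Hahn-Banach theorem for sublinear functionals *)

Section HahnBanach.
Context (R : realType) (V : lmodType R).
Implicit Types (p q : V -> R) (x y : V) (s t : R).

(** Asking only for an inequality in the homogeneity leaves less to check for
    an infimum; equality follows by inverting the scalar ([sublinearZ]). *)
Definition sublinear p :=
  (forall x y, p (x + y) <= p x + p y) /\
  (forall t x, 0 <= t -> p (t *: x) <= t * p x).

Lemma sublinear0 p : sublinear p -> p 0 = 0.
Proof.
move=> [pD pZ]; have := pD 0 0; have := pZ 0 0 (lexx _).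
by rewrite scale0r addr0 => ? ?; lra.
Qed.

Lemma sublinearZ p t x : sublinear p -> 0 <= t -> p (t *: x) = t * p x.
Proof.
move=> sp; rewrite le_eqVlt => /predU1P[<-|t0].
  by rewrite scale0r mul0r sublinear0.
have [_ pZ] := sp; apply/le_anti; rewrite pZ ?(ltW t0)//=.
have := pZ t^-1 (t *: x); rewrite invr_ge0 (ltW t0) => /(_ isT).
by rewrite scalerA mulVf ?gt_eqF// scale1r ler_pdivlMl.
Qed.

Lemma sublinear_geN p x : sublinear p -> - p (- x) <= p x.
Proof.
by move=> sp; have := sp.1 x (- x); rewrite subrr sublinear0//; move=> ?; lra.
Qed.

(** The infima are finite: fix a member p0.  Any other member q either lies
    above p0, so that q x >= p0 x >= - p0 (- x), or lies below it, so that
    q x >= - q (- x) >= - p0 (- x). *)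
Lemma sublinear_inf_chain (F : set (V -> R)) :
  F !=set0 -> (forall q, F q -> sublinear q) ->
  total_on F (fun q r => forall x, r x <= q x) ->
  [/\ sublinear (fun x => inf [set q x | q in F]) &
      forall q x, F q -> inf [set r x | r in F] <= q x].
Proof.
move=> [p0 Fp0] Fs Ftot.
have lbF q x : F q -> inf [set r x | r in F] <= q x.
  move=> Fq; apply: ge_inf; last by exists q.
  exists (- p0 (- x)) => _ [r Fr <-].
  case: (Ftot p0 r Fp0 Fr) => [/(_ (- x))|/(_ x)].
    by have := sublinear_geN x (Fs _ Fr); lra.
  by have := sublinear_geN x (Fs _ Fp0); lra.
have ne x : [set r x | r in F] !=set0 by exists (p0 x); exists p0.
split=> //; split=> [x y|t x] /=.
  rewrite -lerBlDr; apply: lb_le_inf => // _ [q Fq <-].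
  rewrite lerBlDr -lerBlDl; apply: lb_le_inf => // _ [r Fr <-].
  rewrite lerBlDl.
  (* Subadditivity is used for the smaller of the two functionals. *)
  case: (Ftot q r Fq Fr) => [rq|qr].
    have := lbF _ (x + y) Fr; have := (Fs _ Fr).1 x y; have := rq x; lra.
  have := lbF _ (x + y) Fq; have := (Fs _ Fq).1 x y; have := qr y; lra.
rewrite le_eqVlt => /predU1P[<-|t0].
  rewrite mul0r scale0r; have := lbF _ 0 Fp0.
  by rewrite sublinear0//; exact: Fs.
rewrite mulrC -ler_pdivrMr//; apply: lb_le_inf => // _ [q Fq <-].
rewrite ler_pdivrMr// mulrC; apply: le_trans (lbF _ _ Fq) _.
by apply: (Fs _ Fq).2; exact: ltW.
Qed.

(** The directional lowering of p: among the sublinear functionals below p it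
    is one that takes the value - p x0 at - x0, as a linear functional with the
    value p x0 at x0 must do. *)
Definition tilt p x0 x :=
  inf [set p (x + t *: x0) - t * p x0 | t in [set t | 0 <= t]].

Lemma tilt_le p x0 x t : sublinear p -> 0 <= t ->
  tilt p x0 x <= p (x + t *: x0) - t * p x0.
Proof.
move=> sp t0; apply: ge_inf; last by exists t.
exists (- p (- x)) => _ [s /= s0 <-].
have := sp.1 (x + s *: x0) (- x).
by rewrite addrAC subrr add0r sublinearZ//; lra.
Qed.

Lemma le_tilt p x0 x a :
  (forall t, 0 <= t -> a <= p (x + t *: x0) - t * p x0) -> a <= tilt p x0 x.
Proof.
move=> pa; apply: lb_le_inf.
  by exists (p (x + 0 *: x0) - 0 * p x0); exists 0 => /=.
by move=> _ [t /= t0 <-]; exact: pa.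
Qed.

Lemma tilt_sublinear p x0 : sublinear p -> sublinear (tilt p x0).
Proof.
move=> sp; split=> [x y|t x].
  rewrite -lerBlDr; apply: le_tilt => s s0.
  rewrite lerBlDr -lerBlDl; apply: le_tilt => t t0; rewrite lerBlDl.
  have := tilt_le x0 (x + y) sp (addr_ge0 s0 t0).
  have := sp.1 (x + s *: x0) (y + t *: x0).
  by rewrite addrACA -scalerDl; lra.
rewrite le_eqVlt => /predU1P[<-|t0].
  rewrite mul0r scale0r; have := tilt_le x0 0 sp (lexx 0).
  by rewrite scale0r addr0 (sublinear0 sp); lra.
rewrite mulrC -ler_pdivrMr//; apply: le_tilt => s s0.
rewrite ler_pdivrMr// mulrC.
have := tilt_le x0 (t *: x) sp (mulr_ge0 (ltW t0) s0).
by rewrite -scalerA -scalerDr (sublinearZ _ sp (ltW t0)); lra.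
Qed.

Lemma tilt_le_id p x0 x : sublinear p -> tilt p x0 x <= p x.
Proof.
move=> sp; have := tilt_le x0 x sp (lexx 0).
by rewrite scale0r addr0 mul0r subr0.
Qed.

Lemma tiltN p x0 : sublinear p -> tilt p x0 (- x0) <= - p x0.
Proof.
move=> sp; have := tilt_le x0 (- x0) sp ler01.
by rewrite scale1r addNr sublinear0//; lra.
Qed.

(** Zorn's lemma, with the infimum as a lower bound of a nonempty chain. *)
Lemma minimal_sublinear p : sublinear p ->
  exists q, [/\ sublinear q, forall x, q x <= p x &
    forall r, sublinear r -> (forall x, r x <= q x) -> forall x, q x <= r x].
Proof.
move=> sp.
pose T := {q : V -> R | sublinear q /\ forall x, q x <= p x}.
pose below (q r : T) := `[< forall x, sval r x <= sval q x >].
pose p' : T := exist _ p (conj sp (fun=> lexx _)).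
have [||F Ftot|q qmin] := @ZL_preorder T p' below.
- by move=> q; apply/asboolP => x.
- move=> r q s /asboolP rq /asboolP qs; apply/asboolP => x.
  exact: le_trans (qs x) (rq x).
- have [->|/set0P[q0 Fq0]] := eqVneq F set0.
    by exists p'.
  have [|_ [q Fq <-]||sq qF] := @sublinear_inf_chain [set sval q | q in F].
  + by exists (sval q0); exists q0.
  + by case: (svalP q).
  + move=> _ _ [q Fq <-] [r Fr <-].
    by case: (Ftot q r Fq Fr) => /asboolP; [left|right].
  have qp x : inf [set r x | r in [set sval q | q in F]] <= p x.
    by apply: le_trans (qF (sval q0) _ _) (proj2 (svalP q0) x); exists q0.
  exists (exist (fun q => sublinear q /\ forall x, q x <= p x) _ (conj sq qp)).
  move=> r Fr; apply/asboolP => x /=.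
  by apply: qF; exists r.
- case: q qmin => q [sq qp] qmin; exists q; split=> // r sr rq.
  have rp x : r x <= p x := le_trans (rq x) (qp x).
  pose r' : T := exist (fun q => sublinear q /\ forall x, q x <= p x) r
    (conj sr rp).
  by have /asboolP := qmin r' (asboolT rq).
Qed.

(** A minimal f equals each of its tilts, so f (- x) <= - f x for every x, and
    this oddness makes a sublinear functional linear.  Minimizing below the tilt
    of p at x0, and not below p, forces f x0 = p x0. *)
Theorem hahn_banach p x0 : sublinear p ->
  exists f : V -> R, [/\ linear f, forall x, f x <= p x & f x0 = p x0].
Proof.
move=> sp.
have [f [sf ftilt fmin]] := minimal_sublinear (tilt_sublinear x0 sp).
have fN x : f (- x) = - f x.
  have := sublinear_geN x sf.
  have := fmin _ (tilt_sublinear x sf) (fun y => tilt_le_id x y sf) (- x).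
  by have := tiltN x sf => ? ? ?; apply/le_anti/andP; split; lra.
have fp x : f x <= p x := le_trans (ftilt x) (tilt_le_id x0 x sp).
have fD x y : f (x + y) = f x + f y.
  have := sf.1 x y; have := sf.1 (- x) (- y).
  by rewrite -opprD !fN => ? ?; lra.
have fZ t x : f (t *: x) = t * f x.
  have [t0|t0] := leP 0 t; first exact: sublinearZ.
  have := @sublinearZ _ (- t) x sf; rewrite scaleNr fN mulNr => /(_ _)/oppr_inj.
  by apply; lra.
exists f; split=> //; first by move=> t x y; rewrite fD fZ.
have := ftilt (- x0); have := tiltN x0 sp; have := fp x0; rewrite fN => ? ? ?.
by apply/le_anti/andP; split; lra.
Qed.
End HahnBanach.

(** * Real parts in the scalar field *)

Section ScalarField.
Context (R : realType) (k : scalars).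
Local Notation K := (scalar_field R k).
Implicit Types (t : R) (z : K).

Definition of_real t : K :=
  match k return scalar_field R k with
  | RealScalars => t | ComplexScalars => t%:C%C end.

Definition re z : R :=
  match k return scalar_field R k -> R with
  | RealScalars => id | ComplexScalars => @complex.Re R end z.

Lemma of_realB : {morph of_real : s t / s - t}.
Proof. by rewrite /of_real; case: k => //= s t; rewrite rmorphB. Qed.

Lemma of_real_monoid : GRing.monoid_morphism of_real.
Proof.
by rewrite /of_real; case: k; split=> //= s t; rewrite rmorphM.
Qed.

HB.instance Definition _ := GRing.isZmodMorphism.Build R K of_real of_realB.
HB.instance Definition _ :=
  GRing.isMonoidMorphism.Build R K of_real of_real_monoid.

Lemma reD : {morph re : y z / y + z}.
Proof. by rewrite /re; case: k => //= -[? ?] [? ?]. Qed.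

Lemma re_of_realM t z : re (of_real t * z) = t * re z.
Proof.
rewrite /re /of_real; case: k z => //= -[a b] /=.
by rewrite mul0r subr0.
Qed.

Lemma of_realK t : re (of_real t) = t.
Proof. by rewrite /re /of_real; case: k. Qed.

Lemma re_le y z : y <= z -> re y <= re z.
Proof. by rewrite /re; case: k y z => //= y z; rewrite lecE => /andP[]. Qed.

Lemma of_real_le s t : (of_real s <= of_real t) = (s <= t).
Proof. by rewrite /of_real; case: k => //=; rewrite lecR. Qed.

Lemma of_real_lt s t : (of_real s < of_real t) = (s < t).
Proof. by rewrite /of_real; case: k => //=; rewrite ltcR. Qed.

Lemma of_real_ge0 t : (0 <= of_real t) = (0 <= t).
Proof. by rewrite -of_real_le rmorph0. Qed.

Lemma of_real_gt0 t : (0 < of_real t) = (0 < t).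
Proof. by rewrite -of_real_lt rmorph0. Qed.

Lemma re1 : re 1 = 1.
Proof. by rewrite -(of_realK 1) rmorph1. Qed.

Lemma reK z : 0 <= z -> of_real (re z) = z.
Proof.
rewrite /of_real /re; case: k z => //= z /ger0_real; exact: RRe_real.
Qed.

Lemma re_gt0 z : 0 < z -> 0 < re z.
Proof. by move=> z0; rewrite -of_real_gt0 (reK (ltW z0)). Qed.

Lemma re_le_norm z : re z <= re `|z|.
Proof.
rewrite /re; case: k z => /= [z|z]; first exact: ler_norm.
have := normc_ge_Re z; rewrite lecE /= => /andP[_]; apply: le_trans.
exact: ler_norm.
Qed.

Lemma re_eq_norm z : re z = re `|z| -> z = `|z|.
Proof.
rewrite /re; case: k z => //= -[a b].
rewrite normc_def /= => eqa; rewrite -eqa; congr Complex.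
have a0 : 0 <= a by rewrite eqa sqrtr_ge0.
have : a ^+ 2 = a ^+ 2 + b ^+ 2.
  by rewrite {1}eqa sqr_sqrtr// addr_ge0 ?sqr_ge0.
by move=> /eqP; rewrite -subr_eq0 opprD addNKr oppr_eq0 sqrf_eq0 => /eqP.
Qed.

(** The number 1 is an extreme point of the unit disk: the real parts of a and
    b are at most 1 and have sum 2. *)
Lemma midpoint_eq1 (y z : K) : `|y| <= 1 -> `|z| <= 1 -> y + z = 2 -> y = 1.
Proof.
move=> y1 z1 yz.
have reyz : re y + re z = 2 by rewrite -reD yz -[2]/(1 + 1 : K) reD !re1.
have := re_le y1; have := re_le z1; rewrite re1.
have := re_le_norm y; have := re_le_norm z => hz hy lz ly.
have ey : re y = re `|y| by lra.
rewrite (re_eq_norm ey) -[LHS]reK// -ey -[RHS](rmorph1 of_real).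
by congr of_real; lra.
Qed.

Lemma unimodular_rotation z : exists2 c : K, `|c| = 1 & c * z = `|z|.
Proof.
have [->|z0] := eqVneq z 0; first by exists 1; rewrite ?normr1 ?mulr0 ?normr0.
exists (`|z| / z); last by rewrite divfK.
by rewrite normrM normfV normr_id divff// normr_eq0.
Qed.

End ScalarField.

(** * Norming functionals over the real or complex field *)

(** The vectors of V with scalar multiplication restricted to the reals, as a
    separate type so that the two module structures do not conflict. *)
Definition real_restriction (R : realType) (k : scalars)
  (V : lmodType (scalar_field R k)) : Type := V.

Section RealRestriction.
Context (R : realType) (k : scalars) (V : lmodType (scalar_field R k)).
Local Notation VR := (real_restriction V).

HB.instance Definition _ := GRing.Zmodule.on VR.

Definition real_scale (t : R) (x : VR) : VR := of_real k t *: (x : V).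

Lemma real_scalerA s t (x : VR) :
  real_scale s (real_scale t x) = real_scale (s * t) x.
Proof. by rewrite /real_scale scalerA -rmorphM. Qed.

Lemma real_scale1r : left_id 1 real_scale.
Proof. by move=> x; rewrite /real_scale rmorph1 scale1r. Qed.

Lemma real_scalerDr : right_distributive real_scale +%R.
Proof. by move=> t x y; rewrite /real_scale scalerDr. Qed.

Lemma real_scalerDl (x : VR) : {morph real_scale^~ x : s t / s + t}.
Proof. by move=> s t; rewrite /real_scale rmorphD scalerDl. Qed.

HB.instance Definition _ := GRing.Zmodule_isLmodule.Build R VR
  real_scalerA real_scale1r real_scalerDr real_scalerDl.

Lemma real_restriction_scale (t : R) (x : VR) :
  t *: x = of_real k t *: (x : V).
Proof. by []. Qed.
End RealRestriction.

(** In the complex case S x = f x - i f (i x). *)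
Lemma extend_scalars (R : realType) (k : scalars)
    (V : lmodType (scalar_field R k)) (f : real_restriction V -> R) :
  linear f -> exists S : V -> (scalar_field R k)^o,
    linear S /\ forall x, re (S x) = f x.
Proof.
case: k V f => V f lf; first by exists f.
have fD x y : f (x + y) = f x + f y by have := lf 1 x y; rewrite !scale1r.
have f0 : f 0 = 0 by have := fD 0 0; rewrite addr0 => ?; lra.
have fZ (t : R) (x : V) : f (t%:C%C *: x) = t * f x.
  by have := lf t x 0; rewrite f0 !addr0.
exists (fun x => Complex (f x) (- f ('i%C *: x))); split=> //.
move=> [a b] x y.
have fc (c d : R) (z : V) : f (Complex c d *: z) = c * f z + d * f ('i%C *: z).
  have -> : Complex c d = c%:C%C + d%:C%C * 'i%C :> R[i].
    by apply/eqP; rewrite eq_complex /=; apply/andP; split; apply/eqP; ring.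
  by rewrite scalerDl -scalerA fD !fZ.
rewrite scalerDr scalerA !fD.
have -> : 'i%C * Complex a b = Complex (- b) a :> R[i].
  by apply/eqP; rewrite eq_complex /=; apply/andP; split; apply/eqP; ring.
rewrite (fc a b) (fc (- b) a); apply/eqP; rewrite eq_complex /=.
by apply/andP; split; apply/eqP; ring.
Qed.

Section NormingFunctional.
Context (R : realType) (k : scalars).
Local Notation K := (scalar_field R k).
Context (X : normedModType K).

Lemma real_norm_sublinear :
  sublinear (fun x : real_restriction X => re `|x : X|).
Proof.
split=> [x y|t x t0].
  by rewrite -reD; apply/re_le/ler_normD.
rewrite real_restriction_scale normrZ -[`|of_real k t|]ger0_norm ?normr_id //.
rewrite ger0_norm ?re_of_realM//.
by rewrite of_real_ge0.
Qed.

(** The Hahn-Banach functional for the norm has |x| as real part of its value at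
    x.  The complex functional has norm at most 1 because S y can be rotated to
    be real, and then it is a value of the real one. *)
Lemma norming_functional (x : X) : x != 0 ->
  exists2 S : dual X, `|S| = 1 & S x = `|x|.
Proof.
move=> x0.
have [f [lf fle fx]] :=
  hahn_banach (x : real_restriction X) real_norm_sublinear.
have [S [lS reS]] := extend_scalars lf.
have SZ c y : S (c *: y) = c * S y.
  have S0 : S 0 = 0.
    by have := lS (-1) 0 0; rewrite scaler0 addr0 scaleN1r addNr.
  by have := lS c y 0; rewrite S0 !addr0.
have Sle y : `|S y| <= `|y|.
  have [c c1 cS] := unimodular_rotation (S y).
  rewrite -[leLHS]reK// -[leRHS]reK// of_real_le -cS -SZ reS.
  by apply: le_trans (fle _) _; rewrite normrZ c1 mul1r.
have Sb : S \in @bounded_linear _ X K^o.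
  by apply/asboolP; split=> //; exists 1 => y; rewrite mul1r.
have Sx : S x = `|x|.
  have reSx : re (S x) = re `|x| by rewrite reS fx.
  have eSx : re `|S x| = re `|x|.
    apply/le_anti; rewrite (re_le (Sle x))/= -reSx; exact: re_le_norm.
  by rewrite (@re_eq_norm _ _ (S x)) ?eSx// -[LHS]reK// eSx reK.
exists (BoundedOperator Sb) => //; apply/le_anti/andP; split.
  by apply: opnorm_le => y y1; apply: le_trans y1; exact: Sle.
have nx : 0 < `|x| by rewrite normr_gt0.
have := le_opnormM (BoundedOperator Sb) x.
by rewrite /= Sx normr_id -{1}[`|x|]mul1r ler_pM2r.
Qed.

Lemma functional_le (f : dual X) x : `|f| = 1 -> `|f x| <= `|x|.
Proof. by move=> f1; rewrite -[leRHS]mul1r -f1; exact: le_opnormM. Qed.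

End NormingFunctional.

(** A norming functional of f in the bidual is evaluation at some x, and a
    norming functional of x shows that |x| is at most 1. *)
Lemma reflexive_attains (R : realType) (k : scalars)
    (X : normedModType (scalar_field R k)) (f : dual X) :
  reflexive_space X -> `|f| = 1 -> exists2 x : X, `|x| = 1 & f x = 1.
Proof.
move=> hX f1.
have f0 : f != 0 by rewrite -normr_eq0 f1 oner_eq0.
have [phi phi1 phif] := @norming_functional R k (dual X) f f0.
have [x xphi] := hX phi.
have fx : f x = 1 by rewrite -f1 -phif -xphi.
exists x => //; apply/le_anti/andP; split; last first.
  by have := functional_le x f1; rewrite fx normr1.
have x0 : x != 0.
  apply/eqP => x0; move: fx; rewrite x0 -(scale0r x) operator_scale scale0r.
  by move=> /esym/eqP; rewrite oner_eq0.
have [S S1 Sx] := norming_functional x0.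
by have := functional_le S phi1; rewrite -xphi /= Sx normr_id S1.
Qed.

(** * Local uniform rotundity implies L_{p,o} *)

Section RotundityAndLpo.
Context (R : realType) (k : scalars).
Local Notation K := (scalar_field R k).

Lemma cvg_squeeze_natSinv (u : nat -> K) (l : K) :
  (forall n, u n <= l) -> (forall n, l - n.+1%:R^-1 <= u n) -> u @ \oo --> l.
Proof.
move=> ul lu; apply/cvgrPdist_lt => e e0.
have re0 := re_gt0 e0.
near=> n.
rewrite ger0_norm ?subr_ge0//; apply: (@le_lt_trans _ _ (n.+1%:R^-1)).
  by rewrite lerBlDr addrC -lerBlDr.
rewrite -(reK (ltW e0)) -(rmorph_nat (of_real (R:=R) k)) -fmorphV of_real_lt.
by near: n; exact: (near_infty_natSinv_lt (PosNum re0)).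
Unshelve. all: by end_near.
Qed.

Context (X : normedModType K).

Lemma LUR_dual_Lpo : locally_uniformly_rotund (dual X) -> property_Lpo X K^o.
Proof.
move=> lur e f e0 f1; apply: contrapT => noeta.
pose bad (n : nat) (x : X) := [/\ `|x| = 1, 1 - n.+1%:R^-1 < `|f x| &
  ~ exists S : dual X, [/\ `|S| = 1, `|S x| = 1 & `|S - f| < e]].
have /choice[x xbad] n : exists x, bad n x.
  apply: contrapT => nox; apply: noeta; exists n.+1%:R^-1.
    by rewrite invr_gt0 ltr0n.
  move=> x x1 fx; apply: contrapT => noS; apply: nox; exists x.
  by split.
have /choice[g hg] n : exists g : dual X,
    [/\ `|g| = 1, `|g (x n)| = 1 & 1 + `|f (x n)| <= `|g + f|].
  have [x1 _ _] := xbad n.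
  have x0 : x n != 0 by rewrite -normr_eq0 x1 oner_eq0.
  have [S S1 Sx] := norming_functional x0.
  have [c c1 cfx] := unimodular_rotation (f (x n)).
  have c0 : c != 0 by rewrite -normr_eq0 c1 oner_eq0.
  (* With this rotation g (x n) and f (x n) are both c^-1 times a nonnegative
     number, so that their moduli add up. *)
  exists (c^-1 *: S); split.
  - by rewrite normrZ normfV c1 invr1 mul1r.
  - by rewrite scaleoE normrZ normfV c1 invr1 mul1r Sx normr_id.
  have := le_opnormM (c^-1 *: S + f) (x n); rewrite x1 mulr1.
  apply: le_trans; rewrite addoE scaleoE Sx x1.
  rewrite -[X in _ <= X]mul1r -{2}c1 -normrM mulrDr cfx.
  have -> : c * (c^-1 *: (1 : K^o)) = 1.
    by rewrite -[_ *: _]/(_ * _) mulr1 divff.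
  by rewrite ger0_norm// addr_ge0.
have gto : (fun n => `|g n + f|) @ \oo --> (2 : K).
  apply: cvg_squeeze_natSinv => n; have [g1 _ gf] := hg n.
    by apply: le_trans (ler_normD _ _) _; rewrite g1 f1.
  apply: le_trans gf; have [_ + _] := xbad n => /ltW; rewrite -(lerD2l 1).
  by rewrite addrA.
have g1 n : `|g n| = 1 by have [] := hg n.
have /cvgrPdist_lt/(_ e e0)[N _ Ng] := lur f g f1 g1 gto.
have [_ _] := xbad N; apply; exists (g N); have [_ gx _] := hg N; split=> //.
by have := Ng N (leqnn N); rewrite sub0r normrN normr_id.
Qed.

(** * L_{p,o} implies strict convexity of the dual *)

(** Monotonicity of the subdifferential of the norm, for the pairs (x, g) and
    (x + t v, S): the functional that norms the displaced point is at least as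
    large on v. *)
Lemma norming_functional_monotone (g S : dual X) (x v : X) (t : R) :
  `|g| = 1 -> `|S| = 1 -> g x = `|x| -> 0 < t ->
  S (x + of_real k t *: v) = `|x + of_real k t *: v| -> re (g v) <= re (S v).
Proof.
move=> g1 S1 gx t0 Sy; rewrite -(ler_pM2l t0) -(lerD2l (re (g x))).
have evalE (h : dual X) :
    h (x + of_real k t *: v) = h x + of_real k t * h v.
  by rewrite addrC operator_linear addrC.
rewrite -(re_of_realM t (g v)) -reD -evalE.
apply: le_trans (re_le_norm _) _.
apply: le_trans (re_le (functional_le _ g1)) _.
rewrite -Sy evalE reD re_of_realM lerD2r gx.
apply: le_trans (re_le_norm _) _.
exact: re_le (functional_le _ S1).
Qed.

(** A functional that norms x almost norms the directions near that of x, since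
    both f and the norm are Lipschitz; the bound on w keeps |x + w| >= 1/2. *)
Lemma near_attainment (f : dual X) (x w : X) :
  `|f| = 1 -> `|x| = 1 -> f x = 1 -> `|w| <= 2^-1 ->
  x + w != 0 /\ `|f (`|x + w|^-1 *: (x + w)) - 1| <= 4 * `|w|.
Proof.
move=> f1 x1 fx w2; set y := x + w.
have hy : 2^-1 <= `|y|.
  have := lerB_normD x w; rewrite x1 -/y; apply: le_trans.
  by rewrite lerBrDr [leRHS]splitr !mul1r lerD2l.
have y0 : 0 < `|y| by apply: lt_le_trans hy; rewrite invr_gt0 ltr0n.
split; first by rewrite -normr_gt0.
have -> : f (`|y|^-1 *: y) - 1 = `|y|^-1 * (f w + (`|x| - `|y|)).
  rewrite operator_scale -[_ *: _]/(_ * _) x1.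
  have -> : f y = f x + f w.
    by have := operator_linear f 1 x w; rewrite !scale1r.
  by rewrite fx addrA [f w + 1]addrC mulrBr mulVf ?gt_eqF.
rewrite normrM normfV normr_id ler_pdivrMl// mulrCA.
have : `|f w + (`|x| - `|y|)| <= 2 * `|w|.
  apply: le_trans (ler_normD _ _) _; rewrite mulr_natl mulr2n lerD//.
    exact: functional_le.
  apply: le_trans (ler_dist_dist _ _) _.
  by rewrite /y opprD addNKr normrN.
move=> /le_trans; apply; rewrite mulrA ler_wpM2r//.
have -> : (2 : K) = 4 * 2^-1.
  by apply: (@mulIf _ (2 : K)); rewrite ?pnatr_eq0// mulfVK ?pnatr_eq0// -natrM.
by rewrite ler_wpM2l ?ler0n.
Qed.

(** The rotation is by S x, which is near 1 as soon as S is near f and f x is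
    near 1. *)
Lemma rotate_to_norming (f S : dual X) (x : X) :
  `|S| = 1 -> `|x| = 1 -> `|S x| = 1 ->
  exists S' : dual X, [/\ `|S'| = 1, S' x = 1 &
    `|S' - f| <= 2 * `|S - f| + `|f x - 1|].
Proof.
move=> S1 x1 Sx1; set l := S x.
have l0 : l != 0 by rewrite -normr_eq0 Sx1 oner_eq0.
exists (l^-1 *: S); split.
- by rewrite normrZ normfV Sx1 invr1 mul1r.
- by rewrite scaleoE -[_ *: _]/(_ * _) mulVf.
have -> : l^-1 *: S - f = (l^-1 - 1) *: S + (S - f).
  by rewrite scalerBl scale1r addrA subrK.
apply: le_trans (ler_normD _ _) _.
rewrite mulr_natl mulr2n -addrA [leLHS]addrC lerD2l normrZ S1 mulr1.
have -> : l^-1 - 1 = - (l^-1 * (l - 1)) by rewrite mulrBr mulVf// mulr1 opprB.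
rewrite normrN normrM normfV Sx1 invr1 mul1r.
have -> : l - 1 = (S - f) x + (f x - 1) by rewrite addrA subrK.
apply: le_trans (ler_normD _ _) _; rewrite lerD2r.
by have := le_opnormM (S - f) x; rewrite x1 mulr1.
Qed.

(** A norm-one functional norming x is unique.  The vector v with g v - f v = 1
    is the direction in which x is moved to contradict L_{p,o}. *)
Lemma Lpo_smooth (f g : dual X) (x : X) : property_Lpo X K^o ->
  `|f| = 1 -> `|g| = 1 -> `|x| = 1 -> f x = 1 -> g x = 1 -> f = g.
Proof.
move=> Lpo f1 g1 x1 fx gx; apply: contrapT => fg.
have [v vfg] : exists v, g v - f v = 1.
  have [w wfg] : exists w, f w <> g w.
    apply: contrapT => nw; apply: fg; apply: operatorP => w.
    by apply: contrapT => fgw; apply: nw; exists w.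
  have d0 : g w - f w != 0 by rewrite subr_eq0; apply/eqP => /esym.
  exists ((g w - f w)^-1 *: w); rewrite !operator_scale -scalerBr.
  exact: mulVf.
pose c : R := re `|v|.
have vc : `|v| = of_real k c by rewrite reK.
have c_gt0 : 0 < c.
  rewrite -(of_real_gt0 k) -vc normr_gt0; apply/eqP => v0.
  move: vfg; rewrite v0 -(scale0r (0 : X)) !operator_scale !scale0r subr0.
  by move=> /esym/eqP; rewrite oner_eq0.
(* At the direction of x + t v with t |v| = d / 4 the value of f is within d of
   1, and the rotated functional will be within less than 2 e + d <= 3 e of f,
   where 3 e = 1 / |v|. *)
pose e : R := (3 * c)^-1.
have e_gt0 : 0 < e by rewrite invr_gt0 mulr_gt0.
have e0 : 0 < of_real k e by rewrite of_real_gt0.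
have [eta eta0 Lf] := Lpo _ f e0 f1.
have reta := re_gt0 eta0.
pose d : R := Num.min (Num.min (re eta / 2) e) 1.
have d_gt0 : 0 < d by rewrite !lt_min divr_gt0// e_gt0 ltr01.
have d_le1 : d <= 1 by rewrite ge_min lexx orbT.
have d_lee : d <= e by rewrite !ge_min lexx orbT.
have d_lteta : of_real k d < eta.
  rewrite -(reK (ltW eta0)) of_real_lt !gt_min.
  by rewrite ltr_pdivrMr// ltr_pMr// ltr1n.
pose t : R := d / (4 * c).
have t_gt0 : 0 < t by rewrite divr_gt0 ?mulr_gt0.
have tv : `|of_real k t *: v| = of_real k (d / 4).
  have <- : t * c = d / 4 by rewrite /t invfM mulrA mulfVK ?gt_eqF.
  rewrite normrZ vc [RHS]rmorphM; congr (_ * _).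
  by rewrite ger0_norm// of_real_ge0 ltW.
have [|y0] := @near_attainment f x (of_real k t *: v) f1 x1 fx.
  rewrite tv -(rmorph_nat (of_real (R:=R) k)) -fmorphV of_real_le.
  by rewrite ler_pdivrMr// (le_trans d_le1)// ler_pdivlMl// mulr1 ler_nat.
set y := x + _ in y0 *; set u := _ *: y => fu.
have {}fu : `|f u - 1| <= of_real k d.
  apply: le_trans fu _; rewrite tv -(rmorph_nat (of_real (R:=R) k)) -rmorphM.
  by rewrite of_real_le mulrC divfK.
have u1 : `|u| = 1 by rewrite normrZ normfV normr_id mulVf ?normr_eq0.
have [|S [S1 Su Sf]] := Lf u u1.
  rewrite ltrBlDr -ltrBlDl.
  apply: le_lt_trans d_lteta; apply: le_trans fu.
  have := lerB_dist (1 : K^o) (f u); rewrite normr1 distrC; apply.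
have [S' [S'1 S'u S'f]] := rotate_to_norming f S1 u1 Su.
have S'y : S' y = `|y|.
  have -> : y = `|y| *: u by rewrite scalerA divff ?normr_eq0// scale1r.
  rewrite operator_scale S'u -[_ *: _]/(_ * _) mulr1.
  by rewrite normrZ u1 mulr1 normr_id.
have gS' := norming_functional_monotone g1 S'1 _ t_gt0 S'y.
have {}gS' : re (g v) <= re (S' v) by apply: gS'; rewrite gx x1.
have S'f_lt : `|S' - f| < of_real k c^-1.
  have -> : c^-1 = 2 * e + e by rewrite /e invfM; field; rewrite gt_eqF.
  apply: le_lt_trans S'f _; rewrite rmorphD rmorphM rmorph_nat.
  apply: ltr_leD; first by rewrite ltr_pM2l// ltr0n.
  by apply: le_trans fu _; rewrite of_real_le.
have S'f_ge : 1 <= re (S' v - f v).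
  have -> : S' v - f v = S' v - g v + (g v - f v) by rewrite addrA subrK.
  rewrite reD vfg re1 lerDr.
  have := gS'; have := reD (S' v - g v) (g v); rewrite subrK => ->.
  by rewrite lerDr.
suff : re (S' v - f v) < 1 by rewrite ltNge S'f_ge.
apply: le_lt_trans (re_le_norm _) _; rewrite -(of_real_lt k) reK// rmorph1.
apply: le_lt_trans (le_opnormM (S' - f) v) _.
rewrite -[ltRHS](rmorph1 (of_real (R:=R) k)) -(@mulVf _ c) ?gt_eqF//.
rewrite rmorphM /= -vc.
by rewrite ltr_pM2r// vc of_real_gt0.
Qed.

Lemma Lpo_dual_strictly_convex :
  reflexive_space X -> property_Lpo X K^o -> strictly_convex (dual X).
Proof.
move=> hX Lpo f g f1 g1 fg.
rewrite lt_neqAle; apply/andP; split; last first.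
  rewrite normrZ normfV normr_nat ler_pdivrMl ?ltr0n// mulr1.
  by apply: le_trans (ler_normD _ _) _; rewrite f1 g1.
apply/eqP => h1; apply: fg.
have [x x1 hx] := reflexive_attains hX h1.
have fgx : f x + g x = 2.
  apply: (@mulfI _ (2^-1 : K)); first by rewrite invr_eq0 pnatr_eq0.
  by rewrite mulVf ?pnatr_eq0.
have fx1 : `|f x| <= 1 by rewrite -x1 functional_le.
have gx1 : `|g x| <= 1 by rewrite -x1 functional_le.
apply: (Lpo_smooth Lpo f1 g1 x1); first exact: midpoint_eq1 fgx.
by apply: midpoint_eq1 fx1 _; rewrite // addrC.
Qed.

End RotundityAndLpo.

Theorem corollary2p2 (R : realType) (k : scalars)
    (X : completeNormedModType (scalar_field R k))
    (hX : reflexive_space X) :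
  (locally_uniformly_rotund (dual X) ->
     property_Lpo X (scalar_field R k)^o) /\
  (property_Lpo X (scalar_field R k)^o ->
     strictly_convex (dual X)).
Proof.
split; first exact: LUR_dual_Lpo.
exact: Lpo_dual_strictly_convex.
Qed.
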